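(* Let $\phi\in\mathcal{A}$ be an almost flow and let $a\in V$. A path $y\in\mathcal{C}(\mathbb{T},V)$ satisfies $y_t=a+\Phi_{0,t}(y)$ for all $t\in\mathbb{T}$ if and only if $y\in\mathcal{P}[\phi,a]$.
   Context: Setting. $V$ is a Banach space with norm $|\cdot|$, $\mathfrak{i}$ is the identity map of $V$, $\mathcal{C}(V,V)$ is the set of continuous maps, $\|f\|_\infty=\sup_a|f(a)|$. $T>0$, $\mathbb{T}=[0,T]$, $\mathbb{T}_+^2=\{(s,t)\in\mathbb{T}^2: s\le t\}$, $\mathbb{T}_+^3=\{(r,s,t)\in\mathbb{T}^3: r\le s\le t\}$. $\delta,\varpi:\mathbb{R}_+\to\mathbb{R}_+$ are non-decreasing with $\delta(0)=\varpi(0)=0$; $\delta_t:=\delta(t)$. $\omega:\mathbb{T}_+^2\to\mathbb{R}_+$ is a control: $\omega_{r,s}+\omega_{s,t}\le\omega_{r,t}$ on $\mathbb{T}_+^3$, $\omega_{s,s}=0$, and $\omega$ is continuous close to its diagonal. Standing assumptions: for some $\varkappa\in(0,1)$, $2\varpi(x/2)\le\varkappa\varpi(x)$ for all $x\ge0$; and $\varkappa+2\delta_T<1$. For $f:V\to V$, $\operatorname{osc}(f,h)=\sup_{|a-b|\le h}|f(a)-f(b)|$. A map $\chi:\mathbb{T}_+^2\to\mathcal{C}(V,V)$, $(s,t)\mapsto\chi_{t,s}$, is of class $\mathcal{O}$ if for some $C\ge0$: $\operatorname{osc}(\chi_{t,s},\ell\varpi(\omega_{r,s}))\le C\delta_T(1+\ell)\varpi(\omega_{r,t})$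 for all $(r,s,t)\in\mathbb{T}_+^3$, $\ell\ge0$; the smallest such $C$ is $\|\chi\|_{\mathcal{O}}$. $\mathcal{F}[\delta]$ is the class of families $\phi=\{\phi_{t,s}\}_{(s,t)\in\mathbb{T}_+^2}$ of maps $V\to V$ with $\phi_{t,s}=\mathfrak{i}+\widehat{\phi}_{t,s}$, $\widehat\phi$ of class $\mathcal{O}$, $\|\widehat\phi\|_{\mathcal{O}}\le1$ and $\|\widehat\phi_{t,s}\|_\infty\le\delta_{t-s}$ for all $(s,t)\in\mathbb{T}_+^2$. For $M\ge0$, $\mathcal{A}[\delta,M]$ is the set of $\phi\in\mathcal{F}[\delta]$ such that $\|\mathfrak{d}\phi_{t,s,r}\|_\infty\le M\varpi(\omega_{r,t})$ on $\mathbb{T}_+^3$, where $\mathfrak{d}\phi_{t,s,r}=\phi_{t,s}\circ\phi_{s,r}-\phi_{t,r}$. Elements of $\mathcal{A}=\bigcup_{\delta,M}\mathcal{A}[\delta,M]$ are called almost flows. $\mathcal{P}[\phi,a,K]$ is the set of $y\in\mathcal{C}(\mathbb{T},V)$ with $y_0=a$ and $|y_t-\phi_{t,s}(y_s)|\le K\varpi(\omega_{s,t})$ for all $(s,t)\in\mathbb{T}_+^2$, and $\mathcal{P}[\phi,a]=\bigcup_{K\ge0}\mathcal{P}[\phi,a,K]$ (D-solutions). The functional $\Phi$ is defined on $\mathcal{P}[\phi,a]$ with values in $\mathcal{C}([0,T],V)$. For a partition $\pi=\{t_i\}_{i=0}^n$ of $\mathbb{T}$ and $t_i\le t_j$ in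 $\pi$ put $\Phi^\pi_{t_i,t_j}(y)=\sum_{k=i}^{j-1}\widehat\phi_{t_{k+1},t_k}(y_{t_k})$; for $y\in\mathcal{P}[\phi,a]$, $\Phi_{s,t}(y)$ is the limit of $\Phi^\pi_{s,t}(y)$ (over partitions $\pi$ containing $s,t$) as the mesh of $\pi$ tends to $0$, and $\Phi(y)_t=\Phi_{0,t}(y)$. It satisfies $\Phi_{r,s}(y)+\Phi_{s,t}(y)=\Phi_{r,t}(y)$ on $\mathbb{T}_+^3$ and, for some constant $A$ (depending on $y$), $|\Phi_{s,t}(y)-\widehat\phi_{t,s}(y_s)|\le A\varpi(\omega_{s,t})$ on $\mathbb{T}_+^2$, and is uniquely determined by these two properties. *)

(* Defs.v *)
From HB Require Import structures.
From mathcomp Require Import all_boot all_order all_algebra.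
From mathcomp Require Import all_classical all_reals all_analysis.

Set Implicit Arguments.
Unset Strict Implicit.
Unset Printing Implicit Defensive.

Import Order.TTheory GRing.Theory Num.Theory.
Import numFieldNormedType.Exports.

Local Open Scope classical_set_scope.
Local Open Scope ring_scope.

(* Functions R_+ -> R_+, paths on [0, T] and families indexed by
   { (s, t) | 0 <= s <= t <= T } are total functions of real arguments of which
   only the values on the intended domain are ever constrained or used.  Index
   order: [omega s t] is omega_{s,t}, whereas [phi t s] is phi_{t,s} (from time
   s to time t). *)

Definition modulus (R : realType) (f : R -> R) : Prop :=
  [/\ f 0 = 0,
      (forall x, 0 <= x -> 0 <= f x) &
      (forall x y, 0 <= x -> x <= y -> f x <= f y)].

(* By compactness of the diagonal of [0, T]^2, every neighbourhood of it
   contains a strip t - s < eta. *)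
Definition control (R : realType) (T : R) (omega : R -> R -> R) : Prop :=
  [/\ (forall s t, 0 <= s -> s <= t -> t <= T -> 0 <= omega s t),
      (forall r s t, 0 <= r -> r <= s -> s <= t -> t <= T ->
         omega r s + omega s t <= omega r t),
      (forall s, 0 <= s -> s <= T -> omega s s = 0) &
      exists2 eta : R, 0 < eta &
        {within [set p : R * R | [/\ 0 <= p.1, p.1 <= p.2, p.2 <= T
                                   & p.2 - p.1 < eta]],
           continuous (fun p : R * R => omega p.1 p.2)}].

Section Flows.
Context {R : realType} {V : completeNormedModType R}.
Implicit Types (T : R) (delta varpi : R -> R) (omega : R -> R -> R).
Implicit Types (phi chi : R -> R -> V -> V) (y : R -> V) (a : V).

Definition supnorm (f : V -> V) : \bar R :=
  ereal_sup [set (`|f x|)%:E | x in [set: V]].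

Definition osc (f : V -> V) (h : R) : \bar R :=
  ereal_sup [set (`|f p.1 - f p.2|)%:E | p in [set p : V * V | `|p.1 - p.2| <= h]].

Definition osc_bound T delta varpi omega chi (C : R) : Prop :=
  forall r s t l : R, 0 <= r -> r <= s -> s <= t -> t <= T -> 0 <= l ->
    (osc (chi t s) (l * varpi (omega r s))
       <= (C * delta T * (1 + l) * varpi (omega r t))%:E)%E.

Definition classO T delta varpi omega chi : Prop :=
  (forall s t, 0 <= s -> s <= t -> t <= T -> continuous (chi t s)) /\
  exists2 C : R, 0 <= C & osc_bound T delta varpi omega chi C.

Definition normO T delta varpi omega chi : \bar R :=
  ereal_inf [set C%:E | C in [set C : R | 0 <= C /\
                                osc_bound T delta varpi omega chi C]].

Definition hat phi : R -> R -> V -> V := fun t s x => phi t s x - x.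

Definition classF T delta varpi omega phi : Prop :=
  [/\ classO T delta varpi omega (hat phi),
      (normO T delta varpi omega (hat phi) <= 1)%E &
      (forall s t, 0 <= s -> s <= t -> t <= T ->
         (supnorm (hat phi t s) <= (delta (t - s))%:E)%E)].

Definition defect phi (t s r : R) : V -> V :=
  fun x => phi t s (phi s r x) - phi t r x.

Definition classA T delta varpi omega (M : R) phi : Prop :=
  classF T delta varpi omega phi /\
  forall r s t, 0 <= r -> r <= s -> s <= t -> t <= T ->
    (supnorm (defect phi t s r) <= (M * varpi (omega r t))%:E)%E.

(* The union of the classes over delta and M; delta ranges over the functions
   compatible with the constant kappa controlling varpi. *)
Definition almost_flow T kappa varpi omega phi : Prop :=
  exists delta : R -> R, exists M : R,
    [/\ modulus delta, kappa + 2 * delta T < 1, 0 <= M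
      & classA T delta varpi omega M phi].

Definition D_solution T varpi omega phi a y : Prop :=
  [/\ {within `[0, T], continuous y}, y 0 = a &
      exists2 K : R, 0 <= K &
        forall s t, 0 <= s -> s <= t -> t <= T ->
          `|y t - phi t s (y s)| <= K * varpi (omega s t)].

(* A partition 0 = t_0 < t_1 < ... < t_n = T is encoded by the sequence
   pi = [:: t_1; ...; t_n] with [itv_partition 0 T pi]; its set of points is
   then 0 :: pi, and t_k = nth 0 (0 :: pi) k. *)
Definition mesh (pi : seq R) : R :=
  \big[Num.max/0]_(k < size pi) (nth 0 (0 :: pi) k.+1 - nth 0 (0 :: pi) k).

Definition Phi_sum phi y (s t : R) (pi : seq R) : V :=
  \sum_(index s (0 :: pi) <= k < index t (0 :: pi))
    hat phi (nth 0 (0 :: pi) k.+1) (nth 0 (0 :: pi) k) (y (nth 0 (0 :: pi) k)).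

(* "mesh tends to 0", over the partitions of [0, T] containing s and t *)
Definition mesh_to0 T (s t : R) : set_system (seq R) :=
  filter_from [set eta : R | 0 < eta]
    (fun eta => [set pi : seq R | [/\ itv_partition 0 T pi, s \in 0 :: pi,
                                      t \in 0 :: pi & mesh pi < eta]]).

Definition Phi T phi y (s t : R) : V :=
  lim (Phi_sum phi y s t @ mesh_to0 T s t).

(* The paths at which Phi makes sense: the limits exist, and Phi_{s,t}(y) is
   close to hat phi_{t,s}(y_s).  Additivity of Phi(y) need not be required: it
   follows from the convergence of the sums. *)
Definition Phi_defined T varpi omega phi y : Prop :=
  (forall s t, 0 <= s -> s <= t -> t <= T ->
     cvg (Phi_sum phi y s t @ mesh_to0 T s t)) /\
  exists A : R, forall s t, 0 <= s -> s <= t -> t <= T ->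
    `|Phi T phi y s t - hat phi t s (y s)| <= A * varpi (omega s t).

End Flows.

(* Main.v *)
Require Import Defs.
From HB Require Import structures.
From mathcomp Require Import all_boot all_order all_algebra.
From mathcomp Require Import all_classical all_reals all_analysis.
From mathcomp Require Import lra.

Set Implicit Arguments.
Unset Strict Implicit.
Unset Printing Implicit Defensive.

Import Order.TTheory GRing.Theory Num.Theory.
Import numFieldNormedType.Exports.

Local Open Scope classical_set_scope.
Local Open Scope ring_scope.

(** The idea.  For a path [y], the increment [y t - y s] telescopes along the
points [t_k] of any partition through [s] and [t], so
[y t - y s - Phi_sum phi y s t pi] is the sum of the one-step errors
[y t_{k+1} - phi t_{k+1} t_k (y t_k)].

If [y] is a D-solution, these errors are at most [K varpi (omega t_k t_{k+1})].
The halving condition on [varpi] makes [varpi x = o(x)] at 0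
([modulus_littleo]), and the continuity of [omega] near the diagonal makes
[omega t_k t_{k+1}] uniformly small when the mesh is small ([control_small]).
Superadditivity of [omega] ([control_sum_le]) then bounds the total error by
[K e (omega s t)] with [e] arbitrarily small.  Hence the sums converge to
[y t - y s] ([Phi_sum_cvg_increment]), that is [Phi_{s,t}(y) = y t - y s], and
both properties of [Phi] and the equation [y t = a + Phi_{0,t}(y)] are
rewritings of the D-solution property.

Conversely, [Phi(y)] is additive, because the sums over a common partition are
([Phi_additive]).  The integral equation therefore gives
[y t - y s = Phi_{s,t}(y)], and the bound on [Phi_{s,t}(y) - hat phi t s (y s)]
is the D-solution bound.  Limits along partitions determine their values only
because partitions of arbitrarily small mesh through two prescribed points
exist ([mesh_to0_filter]). *)

(** * The remainder is small compared with its argument *)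

(** Each halving of the argument gains a factor [kappa] over linear decay.  The
factor 2 comes from the coarsest dyadic interval, on which [x] may be as small
as one half while [varpi x] is only known to be at most [varpi 1]. *)
Lemma modulus_dyadic_bound (R : realType) (kappa : R) (varpi : R -> R)
    (n : nat) (x : R) :
  0 <= kappa -> modulus varpi ->
  (forall x, 0 <= x -> 2 * varpi (x / 2) <= kappa * varpi x) ->
  2^-1 ^+ n.+1 <= x -> x <= 2^-1 ^+ n -> varpi x <= 2 * varpi 1 * kappa ^+ n * x.
Proof.
move=> k0 [_ v0 vmono] vhalf; elim: n x => [|n IH] x.
  rewrite expr1 !expr0 mulr1 => x1 x2.
  have := vmono x 1 _ x2; have := v0 1 ler01; nra.
rewrite !(exprS 2^-1) => x1 x2.
have e0 : 0 <= (2^-1 : R) ^+ n by rewrite exprn_ge0.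
have x0 : 0 <= x by rewrite (le_trans _ x1)// !mulr_ge0.
have := IH (2 * x); have := vhalf (2 * x).
rewrite (_ : 2 * x / 2 = x); last by lra.
rewrite !exprS => /(_ ltac:(lra)) h1 /(_ ltac:(lra) ltac:(lra)) h2.
have : kappa * varpi (2 * x) <= kappa * (2 * varpi 1 * kappa ^+ n * (2 * x)).
  exact: ler_wpM2l.
lra.
Qed.

(** On the [m]-th dyadic interval the ratio of [varpi x] to [x] is at most a
constant times [kappa ^+ m], and small [x] lie in intervals of large index. *)
Lemma modulus_littleo (R : realType) (kappa : R) (varpi : R -> R) :
  0 <= kappa -> kappa < 1 -> modulus varpi ->
  (forall x, 0 <= x -> 2 * varpi (x / 2) <= kappa * varpi x) ->
  forall e, 0 < e ->
    exists2 h : R, 0 < h & forall x, 0 <= x -> x < h -> varpi x <= e * x.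
Proof.
move=> k0 k1 vm vhalf e e0; have [vz v0 _] := vm.
have C0 : 0 <= 2 * varpi 1 by rewrite mulr_ge0// v0.
set C := 2 * varpi 1 in C0 *.
have [N CN] : exists N, C * kappa ^+ N <= e.
  have : \forall n \near \oo, `|0 - kappa ^+ n| < e / (C + 1).
    apply: cvgr_dist_lt; last by rewrite divr_gt0// ltr_wpDl.
    by apply: cvg_expr; rewrite ger0_norm.
  move=> [N _ /(_ N (leqnn N))]/=; rewrite sub0r normrN ger0_norm ?exprn_ge0//.
  rewrite ltr_pdivlMr ?ltr_wpDl// => h; exists N.
  have := exprn_ge0 N k0; nra.
(* For [x] below this threshold, the index [m] of its dyadic interval is at
   least [N]. *)
exists (2^-1 ^+ N); first by rewrite exprn_gt0.
move=> x; rewrite le_eqVlt => /predU1P[<- _|x0 xN]; first by rewrite vz mulr0.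
have [m0 hm0] : exists m, 2^-1 ^+ m.+1 <= x.
  have : \forall n \near \oo, `|0 - 2^-1 ^+ n| < x.
    by apply: cvgr_dist_lt => //; apply: cvg_expr; rewrite ger0_norm// invf_lt1// ltr1n.
  move=> [N' _ /(_ N'.+1 (leqnSn N'))]/=; rewrite sub0r normrN ger0_norm ?exprn_ge0//.
  by move=> /ltW h; exists N'.
have := ex_intro (fun m => 2^-1 ^+ m.+1 <= x) m0 hm0.
move=> {m0 hm0} /ex_minnP[m mx mmin].
have xm : x <= 2^-1 ^+ m.
  case: m mx mmin => [|m] mx mmin.
    by rewrite (le_trans (ltW xN))// exprn_ile1// invf_le1// ler1n.
  by rewrite leNgt; apply/negP => /ltW /mmin; rewrite ltnn.
have Nm : (N <= m)%N.
  rewrite leqNgt; apply/negP => mN.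
  have : (2^-1 : R) ^+ N <= 2^-1 ^+ m.+1.
    by apply: ler_wiXn2l => //; rewrite invf_le1// ler1n.
  lra.
have := modulus_dyadic_bound k0 vm vhalf mx xm.
move=> /le_trans; apply; apply: ler_wpM2r; first exact: ltW.
apply: le_trans CN; apply: ler_wpM2l => //.
by apply: ler_wiXn2l => //; exact: ltW.
Qed.

(** * The control is uniformly small near the diagonal *)

(** The control is continuous and vanishes at each point of the diagonal, and
compactness of [0, T] makes the resulting local bounds uniform. *)
Lemma control_small (R : realType) (T : R) (omega : R -> R -> R) :
  control T omega -> forall h, 0 < h ->
  exists2 eta : R, 0 < eta & forall s t, 0 <= s -> s <= t -> t <= T ->
    t - s < eta -> omega s t < h.
Proof.
move=> [_ _ odiag [eta0 eta00 /subspace_continuousP ocont]] h h0.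
pose P (eta s : R) := forall t, s <= t -> t <= T -> 0 <= s -> t - s < eta ->
  omega s t < h.
have /compact_near_coveringP cover := @segment_compact R 0 T.
have {cover} : \forall eta \near 0^'+, `[0, T] `<=` P eta.
  apply: (cover R (0^'+) P) => s.
  rewrite /= in_itv /= => /andP[s0 sT].
  have ss : [set p : R * R | [/\ 0 <= p.1, p.1 <= p.2, p.2 <= T
                             & p.2 - p.1 < eta0]] (s, s).
    by split; rewrite /= ?subrr.
  have /cvgrPdist_lt /(_ h h0) := ocont (s, s) ss.
  rewrite /from_subspace /= odiag// => -[] /= [U W] /=.
  move=> [/nbhs_ballP[d1 /= d10 Ud] /nbhs_ballP[d2 /= d20 Wd]] UW.
  (* The half leaves room for the second coordinate: [s'] is within [d] of [s],
     and [t] within [d] of [s']. *)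
  pose d := Num.min d1 d2 / 2.
  have d0 : 0 < d by rewrite divr_gt0// lt_min d10.
  exists (ball s d, [set i : R | 0 < i /\ i < Num.min d eta0]) => /=.
    split; first exact: nbhsx_ballx.
    near=> i; split => //; near: i; apply: nbhs_right_lt.
    by rewrite lt_min d0.
  move=> [s' i] /= [+ [i0]]; rewrite /ball/= lt_min => sd /andP[id ieta].
  move=> t st tT s'0 ti.
  have dd1 : 2 * d <= d1 by rewrite /d mulrC mulfVK// ge_min lexx.
  have dd2 : 2 * d <= d2 by rewrite /d mulrC mulfVK// ge_min lexx orbT.
  have := UW (s', t); rewrite /= sub0r normrN => /(_ _ _)/ltr_normlW; apply.
    split=> /=.
      by apply: Ud; rewrite /ball/=; lra.
    apply: Wd; rewrite /ball/=.
    rewrite (_ : s - t = (s - s') + (s' - t)); last by lra.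
    rewrite (le_lt_trans (ler_normD _ _))// (distrC s') (ger0_norm (_ : 0 <= t - s')).
      lra.
    by rewrite subr_ge0.
  by split=> //; lra.
move=> Peta.
have [eta [/= eta_gt0 Peta1]] := filter_ex (filterI (nbhs_right_gt 0) Peta).
exists eta => // s t s0 st tT ts; apply: (Peta1 s) => //=.
by rewrite in_itv /= s0 (le_trans st).
Unshelve. all: by end_near. Qed.

(** * Sums over the points of a partition *)

Section PartitionPoints.
Context {R : realType} (T : R) (pi : seq R) (hpi : itv_partition 0 T pi).

Lemma partition_point_itv k : (k <= size pi)%N -> 0 <= nth 0 (0 :: pi) k <= T.
Proof.
move=> kn; rewrite (set_nth_default T)// (@itv_partition_nth_ge _ _ 0 T)//.
exact: itv_partition_nth_le hpi.
Qed.

Lemma partition_point_ltS k : (k < size pi)%N ->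
  nth 0 (0 :: pi) k < nth 0 (0 :: pi) k.+1.
Proof. by move=> kn; have [/(pathP 0) h _] := hpi; exact: h. Qed.

Lemma partition_step_mesh k : (k < size pi)%N ->
  nth 0 (0 :: pi) k.+1 - nth 0 (0 :: pi) k <= mesh pi.
Proof.
move=> kn; exact: (@le_bigmax _ _ _ 0
  (fun k : 'I_(size pi) => nth 0 (0 :: pi) k.+1 - nth 0 (0 :: pi) k) (Ordinal kn)).
Qed.

Lemma partition_index_le s t : s \in 0 :: pi -> t \in 0 :: pi -> s <= t ->
  (index s (0%R :: pi) <= index t (0%R :: pi))%N.
Proof.
move=> spi tpi; rewrite leqNgt; apply: contraTN => ts; rewrite -ltNge.
rewrite -[X in X < _](nth_index 0 tpi) -[X in _ < X](nth_index 0 spi).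
have hs : sorted <%R (0 :: pi) by case: hpi.
by apply: (sorted_ltn_nth lt_trans 0 hs) => //; rewrite inE index_mem.
Qed.

Lemma control_sum_le (omega : R -> R -> R) i j : control T omega ->
  (i <= j)%N -> (j <= size pi)%N ->
  \sum_(i <= k < j) omega (nth 0 (0 :: pi) k) (nth 0 (0 :: pi) k.+1)
    <= omega (nth 0 (0 :: pi) i) (nth 0 (0 :: pi) j).
Proof.
move=> [_ osup odiag _]; elim: j => [|j IH].
  rewrite leqn0 => /eqP-> _; rewrite big_geq// odiag//.
  by have /andP[] := @partition_point_itv 0%N (leq0n _).
rewrite leq_eqVlt => /predU1P[->|].
  by move=> /partition_point_itv /andP[? ?]; rewrite big_geq// odiag.
rewrite ltnS => ij jn; rewrite big_nat_recr//=.
have /andP[i0 _] := partition_point_itv (leq_trans ij (ltnW jn)).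
have /andP[_ jT] := partition_point_itv jn.
apply: le_trans (osup _ (nth 0 (0 :: pi) j) _ _ _ _ _) => //.
- by rewrite lerD2r; apply: IH => //; exact: ltnW.
- have hs : sorted <%R (0 :: pi) by case: hpi.
  apply: (sorted_leq_nth le_trans lexx) => //; first by apply: (sub_sorted (@ltW _ _)).
    by rewrite inE /= ltnS (leq_trans ij)// ltnW.
  by rewrite inE /= ltnS ltnW.
- exact/ltW/partition_point_ltS.
Qed.

Lemma Phi_sum_additive (V : completeNormedModType R) (phi : R -> R -> V -> V)
    (y : R -> V) r s t :
  r \in 0 :: pi -> s \in 0 :: pi -> t \in 0 :: pi -> r <= s -> s <= t ->
  Phi_sum phi y r s pi + Phi_sum phi y s t pi = Phi_sum phi y r t pi.
Proof.
by move=> rpi spi tpi rs st; rewrite /Phi_sum -big_cat_nat//; exact: partition_index_le.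
Qed.

End PartitionPoints.

(** * Partitions of small mesh *)

Section FinePartitions.
Context {R : realType}.
Implicit Types (T eta a b s t : R).

(** Walk from [a] in steps of half the admissible gap, so that every step, the
last one included, is strictly shorter than [eta]. *)
Lemma fine_partition eta a b : 0 < eta -> a <= b ->
  exists2 pi, itv_partition a b pi & path (fun u v => v - u < eta) a pi.
Proof.
move=> eta0; have [n] : exists n : nat, b - a <= n%:R * (eta / 2).
  exists (Num.truncn ((b - a) / (eta / 2))).+1.
  rewrite -ler_pdivrMr ?divr_gt0//; exact/ltW/truncnS_gt.
elim: n a => [|n IH] a.
  rewrite mul0r subr_le0 => ba ab; exists [::] => //.
  by split => //=; apply/eqP/le_anti; rewrite ab.
rewrite -natr1 => ban ab; have [bae|bae] := ltP (b - a) eta.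
  have [->|anb] := eqVneq a b; first by exists [::].
  exists [:: b]; last by rewrite /= bae.
  by apply: itv_partition1; rewrite lt_neqAle anb.
have [||pi [pi1 pi2] pi3] := IH (a + eta / 2); [lra..|].
exists (a + eta / 2 :: pi) => /=.
  by split=> //=; rewrite pi1 andbT; lra.
by rewrite pi3 andbT; lra.
Qed.

Lemma mesh_lt eta pi : 0 < eta -> path (fun u v => v - u < eta) 0 pi ->
  mesh pi < eta.
Proof.
by move=> eta0 /pathP h; apply: bigmax_lt => // k _; apply: (h 0).
Qed.

(** Concatenating fine partitions of [0, s], [s, t] and [t, T] makes [s] and [t]
partition points without any sorting or merging. *)
Lemma fine_partition_through eta T s t : 0 < eta ->
  0 <= s -> s <= t -> t <= T ->
  exists pi, [/\ itv_partition 0 T pi, s \in 0 :: pi, t \in 0 :: pi & mesh pi < eta].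
Proof.
move=> eta0 s0 st tT.
have [p1 P1 F1] := fine_partition eta0 s0.
have [p2 P2 F2] := fine_partition eta0 st.
have [p3 P3 F3] := fine_partition eta0 tT.
have /eqP l1 := P1.2; have /eqP l2 := P2.2.
exists (p1 ++ p2 ++ p3); split.
- exact: itv_partition_cat P1 (itv_partition_cat P2 P3).
- by rewrite -cat_cons mem_cat -[X in X \in _ :: p1]l1 mem_last.
- by rewrite -cat_cons catA mem_cat -{1}l2 -{1}l1 -last_cat mem_last.
- by apply: mesh_lt => //; rewrite !cat_path F1 l1 F2 l2.
Qed.

Lemma mesh_to0_filter T s t : 0 <= s -> s <= t -> t <= T ->
  ProperFilter (mesh_to0 T s t).
Proof.
move=> s0 st tT; apply: filter_from_proper => [|eta eta0]; last first.
  by have [pi ?] := fine_partition_through eta0 s0 st tT; exists pi.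
apply: filter_from_filter => [|eta1 eta2 e1 e2]; first by exists 1 => /=.
exists (Num.min eta1 eta2); first by rewrite /= lt_min e1.
by move=> pi [] ? ? ?; rewrite lt_min => /andP[].
Qed.

End FinePartitions.

(** * The functional and the increments of the path *)

Section Phi.
Context {R : realType} {V : completeNormedModType R} (T : R).
Variables (phi : R -> R -> V -> V) (y : R -> V).

Lemma Phi_xx s : 0 <= s -> s <= T -> Phi T phi y s s = 0.
Proof.
move=> s0 sT; have FF := mesh_to0_filter s0 (lexx s) sT.
apply: cvg_lim; first exact: norm_hausdorff.
by apply: cvg_near_cst; near=> pi; rewrite /Phi_sum big_geq.
Unshelve. all: by end_near. Qed.

(** The three limits are taken along different families of partitions; all three
can be computed along the partitions through both [s] and [t], where the sums
add up exactly. *)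
Lemma Phi_additive s t : 0 <= s -> s <= t -> t <= T ->
  (forall s t, 0 <= s -> s <= t -> t <= T ->
     cvg (Phi_sum phi y s t @ mesh_to0 T s t)) ->
  Phi T phi y 0 s + Phi T phi y s t = Phi T phi y 0 t.
Proof.
move=> s0 st tT cv; have FF := mesh_to0_filter s0 st tT.
have sub u v : u \in [:: 0; s; t] -> v \in [:: 0; s; t] ->
    mesh_to0 T s t `=>` mesh_to0 T u v.
  move=> us vs A [eta eta0 Aeta]; exists eta => // pi [piT spi tpi pim].
  by apply: Aeta; split => //; [move: us|move: vs]; rewrite !inE;
    case/or3P => /eqP->; rewrite ?eqxx.
have lim0s : Phi_sum phi y 0 s @ mesh_to0 T s t --> Phi T phi y 0 s.
  apply: cvg_trans (cv 0 s _ _ _) => //; last exact: le_trans tT.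
  by apply: cvg_app; apply: sub; rewrite !inE eqxx ?orbT.
have lim0t : Phi_sum phi y 0 t @ mesh_to0 T s t --> Phi T phi y 0 t.
  apply: cvg_trans (cv 0 t _ _ _) => //; last exact: le_trans st.
  by apply: cvg_app; apply: sub; rewrite !inE eqxx ?orbT.
have limD : Phi_sum phi y 0 s + Phi_sum phi y s t @ mesh_to0 T s t -->
    Phi T phi y 0 s + Phi T phi y s t by apply: cvgD => //; exact: cv.
have <- := cvg_lim (@norm_hausdorff _ V) limD.
apply: cvg_lim; first exact: norm_hausdorff.
apply: cvg_trans lim0t; apply: near_eq_cvg.
exists 1 => //= pi [piT spi tpi _] /=.
by apply/esym/(Phi_sum_additive piT) => //; exact: mem_head.
Qed.

(** The error of the sums is at most [K] times the sum of
[varpi (omega t_k t_{k+1})], which a fine mesh brings below any prescribed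
positive multiple of [omega s t]. *)
Lemma Phi_sum_cvg_increment (kappa : R) (varpi : R -> R) (omega : R -> R -> R) K :
  0 <= kappa -> kappa < 1 -> modulus varpi ->
  (forall x, 0 <= x -> 2 * varpi (x / 2) <= kappa * varpi x) ->
  control T omega -> 0 <= K ->
  (forall s t, 0 <= s -> s <= t -> t <= T ->
     `|y t - phi t s (y s)| <= K * varpi (omega s t)) ->
  forall s t, 0 <= s -> s <= t -> t <= T ->
  Phi_sum phi y s t @ mesh_to0 T s t --> y t - y s.
Proof.
move=> k0 k1 vm vhalf oc K0 hK s t s0 st tT.
have FF := mesh_to0_filter s0 st tT; have [om_ge0 _ _ _] := oc.
apply/cvgrPdist_lt => eps eps0.
have M0 : 0 <= K * omega s t by rewrite mulr_ge0// om_ge0.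
(* The added 1 keeps the denominator positive when [K * omega s t] vanishes. *)
pose e := eps / (K * omega s t + 1).
have e0 : 0 < e by rewrite divr_gt0// ltr_wpDl.
have [h h0 hv] := modulus_littleo k0 k1 vm vhalf e0.
have [eta eta0 ho] := control_small oc h0.
exists eta => // pi [piT spi tpi pim] /=.
pose x := nth 0 (0 :: pi).
have ij := partition_index_le piT spi tpi st.
have jn : (index t (0%R :: pi) <= size pi)%N by rewrite -ltnS index_mem.
rewrite -{1}(nth_index 0 tpi) -{1}(nth_index 0 spi) -/x.
rewrite -(@telescope_sumr _ _ _ (y \o x))// /Phi_sum -sumrB.
apply: (@le_lt_trans _ _ (\sum_(index s (0 :: pi) <= k < index t (0 :: pi))
    K * (e * omega (x k) (x k.+1)))).
  apply: (le_trans (ler_norm_sum _ _ _)); rewrite !big_nat; apply: ler_sum => k /andP[_ kj].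
  have kn := leq_trans kj jn.
  have /andP[xk0 _] := partition_point_itv piT (ltnW kn).
  have /andP[_ xkT] := partition_point_itv piT kn.
  have xkk := ltW (partition_point_ltS piT kn).
  rewrite /hat /= opprB addrA subrK.
  apply: (le_trans (hK _ _ xk0 xkk xkT)); rewrite ler_wpM2l// hv ?om_ge0//.
  by apply: ho => //; apply: le_lt_trans pim; exact: partition_step_mesh.
rewrite -!mulr_sumr.
apply: (@le_lt_trans _ _ (K * (e * omega s t))).
  rewrite !ler_wpM2l ?(ltW e0)//.
  have := control_sum_le piT oc ij jn.
  by rewrite !nth_index.
by rewrite mulrCA mulrAC ltr_pdivrMr ?ltr_wpDl// ltr_pM2l//; lra.
Qed.

End Phi.

Theorem proposition2 (R : realType) (V : completeNormedModType R)
    (T : R) (hT : 0 < T)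
    (kappa : R) (hkappa0 : 0 < kappa) (hkappa1 : kappa < 1)
    (varpi : R -> R) (hvarpi : modulus varpi)
    (hvarpi_kappa : forall x, 0 <= x -> 2 * varpi (x / 2) <= kappa * varpi x)
    (omega : R -> R -> R) (homega : control T omega)
    (phi : R -> R -> V -> V) (hphi : almost_flow T kappa varpi omega phi)
    (a : V) (y : R -> V) (hy : {within `[0, T], continuous y}) :
  (Phi_defined T varpi omega phi y /\
   forall t, 0 <= t -> t <= T -> y t = a + Phi T phi y 0 t)
  <-> D_solution T varpi omega phi a y.
Proof.
split.
  move=> [[cv [A hA]] yE]; split => //.
    by rewrite (yE 0 (lexx 0) (ltW hT)) (Phi_xx _ _ (lexx 0) (ltW hT)) addr0.
  (* The constant attached to [Phi] has no prescribed sign, that of a D-solution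
     does. *)
  exists (Num.max A 0); first by rewrite le_max lexx orbT.
  move=> s t s0 st tT.
  have -> : y t - phi t s (y s) = Phi T phi y s t - hat phi t s (y s).
    rewrite yE ?(le_trans s0)// -(Phi_additive s0 st tT cv) addrA -yE ?(le_trans st)//.
    by rewrite /hat opprB addrA [y s + _]addrC.
  apply: (le_trans (hA s t s0 st tT)); apply: ler_wpM2r; last by rewrite le_max lexx.
  by have [_ v0 _] := hvarpi; have [om_ge0 _ _ _] := homega; rewrite v0// om_ge0.
move=> [_ y0 [K K0 hK]].
have cv := Phi_sum_cvg_increment (ltW hkappa0) hkappa1 hvarpi hvarpi_kappa homega K0 hK.
have PhiE s t : 0 <= s -> s <= t -> t <= T -> Phi T phi y s t = y t - y s.
  move=> s0 st tT; have FF := mesh_to0_filter s0 st tT.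
  by apply: cvg_lim; [exact: norm_hausdorff|exact: cv].
split; last by move=> t t0 tT; rewrite PhiE// y0 addrC subrK.
split=> [s t s0 st tT|]; first by apply/cvg_ex; exists (y t - y s); exact: cv.
exists K => s t s0 st tT; rewrite PhiE// /hat opprB addrA subrK; exact: hK.
Qed.
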